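(* Let $\Sigma\subset\mathbb{R}^2$ be a compact planar surface, $D\subset\Sigma$ a tangle diagram with no closed link components, and $U\subset\mathrm{int}(\Sigma)$ a compact subsurface whose boundary is transverse to $D$ and avoids crossing points. Let $A_D$ and $A_{D/U}$ be transition matrices of $D$ and of the contraction $D/U$. If the contracted region $U$ admits no cycles, then $$\det(I-A_D)=\det(I-A_{D/U}).$$ Equivalently, $\det(G_D)=\det(G_{D/U})$, where $G_D=(I-A_D)^{-1}$ and $G_{D/U}=(I-A_{D/U})^{-1}$ are the Green's matrices.
   Context: **Markov chains.** A Markov chain $M=(\mathcal{S},a)$ consists of a finite set of states $\mathcal{S}=\mathcal{S}(M)$ and a transition function $a=a_M:\mathcal{S}\times\mathcal{S}\to\mathbb{Z}(T)$; ordering the states gives the transition matrix $A_M=(a(s_i,s_j))$. A walk from $s$ to $t$ is a finite sequence of states $w=s_1\cdots s_k$ with $s_1=s$, $s_k=t$, $k\ge1$, $a(s_i,s_{i+1})\ne0$ for $1\le i<k$; its weight is $a(w)=\prod_{i=1}^{k-1}a(s_i,s_{i+1})$. The Green's function is $g_M(s,t)=\sum_w a(w)$ over all walks from $s$ to $t$, whenever this converges. A cycle of $M$ is a non-empty finite sequence $s_1\cdots s_k$ of states, up to cyclic permutation, with $a(s_1,s_2)a(s_2,s_3)\cdots a(s_{k-1},s_k)a(s_k,s_1)\neq0$. **Tangle diagrams.** A tangle diagram $D\subset\Sigma$ is the oriented image of a generic projection of a proper embedding of an oriented compact 1-manifold in $\Sigma\times I$, with over/under information at crossings. Its strands are the components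 of $D$ minus the crossing points; a strand meeting $\partial\Sigma$ is incoming if its orientation there points into $\Sigma$ and outgoing otherwise. $D$ determines a Markov chain, also denoted $D$, with states $\mathcal{S}(D)$ the strands of $D$: at a crossing of sign $\sigma$ with incoming over-strand $i$, incoming under-strand $j$, outgoing over-strand $i^+$ and outgoing under-strand $j^+$, $a_D(i,i^+)=T^\sigma$, $a_D(i,j^+)=1-T^\sigma$, $a_D(j,j^+)=1$; all other values are $0$. If $D$ has no closed components, then $g_D$ converges absolutely to a rational function in $\mathbb{Z}(T)$ for all $T$ in an open neighborhood of $1\in\mathbb{C}$. **Contraction.** $U$ defines two subdiagrams $D\cap U$ and $D\cap(\Sigma-U)$, denoted $U$ and $D-U$. Via inclusion their strands $\mathcal{S}(U)$ and $\mathcal{S}(D-U)$ are identified with subsets of $\mathcal{S}(D)$ (so each strand of $D$ meets $\partial U$ in at most one point), and $\mathcal{S}(U)\cap\mathcal{S}(D-U)$ consists of the incoming strands $\mathcal{I}$ and the outgoing strands $\mathcal{O}$ of $U$. The contraction $D/U$ is the Markov chain with states $\mathcal{S}(D/U)=\mathcal{S}(D-U)$ and transition function $$a_{D/U}(s,t)=\begin{cases}g_U(s,t)& s\in\mathcal{I},\ t\in\mathcal{O}\\ a_D(s,t)&\text{otherwise,}\end{cases}$$ where $g_U$ is the Green's function of the Markov chain of the tangle diagram $U$ (i.e. the sum of weights over walks taking place inside $U$). ''$U$ admits no cycles'' means the Markov chain of the tangle diagram $U$ has no cycles. *)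

(* Defs.v *)
From mathcomp Require Import all_boot all_order all_algebra.
From mathcomp Require Import all_classical all_reals all_analysis.

Set Implicit Arguments.
Unset Strict Implicit.
Unset Printing Implicit Defensive.

Import Order.TTheory GRing.Theory Num.Theory.
Import numFieldNormedType.Exports.

Local Open Scope classical_set_scope.
Local Open Scope ring_scope.

(** * Markov chains over Z(T) *)

Notation ZT := {fraction {poly int}}.

Definition varT : ZT := tofrac 'X.

(* The state set is a subset of an ambient type, so that the chains of a
   diagram, of its subdiagrams and of its contractions share their states. *)
Record markov_chain (S : Type) := MarkovChain {
  states : set S;
  trans : S -> S -> ZT }.

Section MarkovChain.
Variables (S : choiceType) (M : markov_chain S).

(* A is the transition matrix for the ordering e of the states. *)
Definition is_transition_matrix n (A : 'M[ZT]_n) : Prop :=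
  exists e : 'I_n -> S,
    set_bij [set: 'I_n] (states M) e /\
    A = \matrix_(i, j) trans M (e i) (e j).

Definition step (s t : S) : bool := trans M s t != 0.

Definition walks (s t : S) : set (seq S) :=
  [set w | exists p, [/\ w = s :: p, last s p = t, path step s p &
                         forall u, u \in w -> states M u]].

Fixpoint weight (w : seq S) : ZT :=
  match w with
  | s :: ((t :: _) as w') => trans M s t * weight w'
  | _ => 1
  end.

(* Walks have nonzero weight, so this is the sum over all walks as soon as
   there are finitely many of them; this is always so for a finite chain
   without cycles. The library's value of an infinite sum is 0. *)
Definition green (s t : S) : ZT := \sum_(w \in walks s t) weight w.

Definition is_cycle (c : seq S) : Prop :=
  [/\ c != [::], cycle step c & forall u, u \in c -> states M u].

Definition acyclic : Prop := forall c, ~ is_cycle c.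

End MarkovChain.

(** * Compact planar surfaces *)

Notation plane R := (R * R)%type.

Section Surface.
Variable R : realType.
Implicit Types (S : set (plane R)) (p v : plane R).

(* Near p, S is the region where f >= 0, with f of class C^1 and p a regular
   point of f lying on the curve f = 0. *)
Definition defining_function S p (f : plane R -> R) : Prop :=
  [/\ f p = 0,
      \forall q \near p, differentiable f q /\
        forall v, {for q, continuous (fun x => 'd f x v)},
      exists v, 'd f p v != 0 &
      \forall q \near p, S q <-> 0 <= f q].

Definition frontier S : set (plane R) := S `\` S°.

Definition compact_surface S : Prop :=
  compact S /\ forall p, frontier S p -> exists f, defining_function S p f.

Definition tangent_to S p v : Prop :=
  exists2 f, defining_function S p f & 'd f p v = 0.

Definition points_into S p v : Prop :=
  exists2 f, defining_function S p f & 0 < 'd f p v.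

End Surface.

(** * Tangle diagrams *)

Definition C1 (R : realType) (V : normedModType R) (f : R -> V) : Prop :=
  (forall t, derivable f t 1) /\ continuous (derive1 f).

Definition cross (R : realType) (u v : plane R) : R := u.1 * v.2 - u.2 * v.1.

(* An oriented compact 1-manifold is a disjoint union of intervals [0, 1] and
   circles; (i, t) is the point of parameter t on its i-th component. Circles
   are parametrized by 1-periodic functions, with fundamental domain [0, 1[. *)
Definition parameters (R : realType) ncomp (circle : 'I_ncomp -> bool) :
    set ('I_ncomp * R) :=
  [set x | 0 <= x.2 /\ if circle x.1 then x.2 < 1 else x.2 <= 1].

Arguments parameters R {ncomp} circle.

(* A proper embedding (curve, height) of a compact oriented 1-manifold in
   Sigma x [0, 1] whose projection is generic. The functions are defined on R,
   but for an interval component only their values on [0, 1] matter. *)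
Record tangle_diagram (R : realType) (Sigma : set (plane R)) := TangleDiagram {
  ncomp : nat;
  is_circle : 'I_ncomp -> bool;
  curve : 'I_ncomp -> R -> plane R;
  height : 'I_ncomp -> R -> R;
  pt := fun x : 'I_ncomp * R => curve x.1 x.2;
  pt_velocity := fun x : 'I_ncomp * R => derive1 (curve x.1) x.2;
  pt_height := fun x : 'I_ncomp * R => height x.1 x.2;
  params : set ('I_ncomp * R) := parameters R is_circle;
  curve_C1 : forall i, C1 (curve i);
  height_C1 : forall i, C1 (height i);
  circle_periodic : forall i, is_circle i -> forall t,
    curve i (t + 1) = curve i t /\ height i (t + 1) = height i t;
  pt_in : forall x, params x -> Sigma (pt x);
  height_in : forall x, params x -> 0 <= pt_height x <= 1;
  properness : forall x, params x ->
    (frontier Sigma (pt x) <-> ~~ is_circle x.1 /\ (x.2 = 0 \/ x.2 = 1));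
  boundary_transverse : forall x, params x -> frontier Sigma (pt x) ->
    ~ tangent_to Sigma (pt x) (pt_velocity x);
  embedding : forall x y, params x -> params y ->
    pt x = pt y -> pt_height x = pt_height y -> x = y;
  immersion : forall x, params x -> pt_velocity x != 0;
  double_points_finite :
    finite_set [set p | exists x y, [/\ params x, params y, x <> y,
                                        pt x = p & pt y = p]];
  double_points_interior : forall x y, params x -> params y -> x <> y ->
    pt x = pt y -> ~ frontier Sigma (pt x);
  no_triple_point : forall x y z, params x -> params y -> params z ->
    pt x = pt y -> pt y = pt z -> [\/ x = y, y = z | x = z];
  double_points_transverse : forall x y, params x -> params y -> x <> y ->
    pt x = pt y -> cross (pt_velocity x) (pt_velocity y) != 0 }.

Section Tangle.
Variables (R : realType) (Sigma : set (plane R)) (D : tangle_diagram Sigma).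
Implicit Types (x y : 'I_(ncomp D) * R) (X : set (plane R)).
Implicit Types (s t : set (plane R)).

Definition no_closed_component : Prop :=
  forall i : 'I_(ncomp D), ~~ is_circle i.

(* x is on the over-branch and y on the under-branch of a crossing. *)
Definition crossing x y : Prop :=
  [/\ params x, params y, pt x = pt y & pt_height y < pt_height x].

Definition crossing_points : set (plane R) :=
  [set p | exists x y, crossing x y /\ pt x = p].

(* +1 when rotating the over-direction counterclockwise by less than a half
   turn gives the under-direction (right-handed crossing), -1 otherwise. *)
Definition crossing_sign x y : int :=
  sgz (cross (pt_velocity x) (pt_velocity y)).

(* The strands of the subdiagram D `&` X, as sets of points. *)
Definition strands_of X : set (set (plane R)) :=
  let A := (@pt _ _ D @` @params _ _ D `&` X) `\` crossing_points in
  [set connected_component A p | p in A].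

Definition strands : set (set (plane R)) := strands_of Sigma.

(* The strands of D `&` X, each one being identified with the strand of D that
   contains it. The identification is injective on the strands of both D `&` X
   and D `\` X when each strand of D meets the frontier of X at most once. *)
Definition substrands X : set (set (plane R)) :=
  [set s | strands s /\ exists2 s', strands_of X s' & s' `<=` s].

Definition arrives s x : Prop := \forall u \near x.2^'-, s (curve x.1 u).
Definition leaves s x : Prop := \forall u \near x.2^'+, s (curve x.1 u).

Inductive transition X s t : ZT -> Prop :=
| over_over x y : crossing x y -> X (pt x) ->
    arrives s x -> leaves t x -> transition X s t (varT ^ crossing_sign x y)
| over_under x y : crossing x y -> X (pt x) ->
    arrives s x -> leaves t y -> transition X s t (1 - varT ^ crossing_sign x y)
| under_under x y : crossing x y -> X (pt x) ->
    arrives s y -> leaves t y -> transition X s t 1.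

(* The Markov chain of the subdiagram D `&` X; xget gives the value prescribed
   at the crossings in X, and 0 when there is none. *)
Definition subchain X : markov_chain (set (plane R)) :=
  {| states := substrands X;
     trans := fun s t => xget 0 (transition X s t) |}.

Definition chain : markov_chain (set (plane R)) := subchain Sigma.

Definition incoming X s : Prop :=
  exists x, [/\ params x, s (pt x), frontier X (pt x) &
                points_into X (pt x) (pt_velocity x)].

Definition outgoing X s : Prop :=
  exists x, [/\ params x, s (pt x), frontier X (pt x) &
                ~ points_into X (pt x) (pt_velocity x)].

Definition transverse_to X : Prop :=
  forall x, params x -> frontier X (pt x) ->
    ~ tangent_to X (pt x) (pt_velocity x).

Definition contracted_chain U : markov_chain (set (plane R)) :=
  {| states := substrands (Sigma `\` U);
     trans := fun s t =>
       if `[< incoming U s /\ outgoing U t >]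
       then green (subchain U) s t
       else trans chain s t |}.

End Tangle.

(* Main.v *)
Require Import Defs.
From mathcomp Require Import all_boot all_order all_algebra.
From mathcomp Require Import perm finmap.
From mathcomp Require Import all_classical all_reals all_analysis.
Import Order.TTheory GRing.Theory Num.Theory numFieldNormedType.Exports.
Local Open Scope classical_set_scope.
Local Open Scope ring_scope.

(** Contracting U is block elimination. Call a strand interior if it lies
    inside U; the other strands are the states of D/U. Ordering the interior
    strands first,
<<
      I - A_D = (  P   -B  )        P = I - A_int,
                ( -C    Q  )        Q = I - A_ext,
>>
    and if P X = B then det (I - A_D) = det P * det (Q - C X). Because U has
    no cycles, A_int is strictly triangular for a suitable order, hence
    det P = 1; and the first-step equation of the Green's function of U says
    that X(u, t) = g_U(u, t) for t outgoing, X(u, t) = 0 otherwise, solves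
    P X = B. The first-step equation at an incoming strand s also gives
    A_ext(s, t) + (C X)(s, t) = g_U(s, t), so Q - C X is I - A_{D/U}. This is
    [det_contraction], an identity about abstract chains.

    What it asks of the diagram is that walks can enter U only through
    incoming strands, leave it only through outgoing strands, and that no
    strand is both. The geometric input is that a strand is an embedded arc
    followed in the direction of its parameter: if v is the parameter of a
    crossing, cutting the diagram at v gives two compact pieces that meet only
    at crossings, so the connected strand lies in one of them ([strand_arc],
    [arrives_after], [leaves_before]). A strand that is not inside U and ends
    at a crossing of U meets the frontier of U exactly once and
    transversally. The side of U on which the arc lies cannot change anywhere
    else, so the frontier point is an entrance: a curve leaving U there could
    not come back ([arrives_inside_incoming]; the same argument gives
    [leaves_inside_outgoing] and [incoming_arrives_inside]).

    For the statement about Green's matrices, I - A_D must be invertible. At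
    T = 1 a walk stays on its component of the tangle, always turning into the
    strand that continues it; as no component is closed, the parameter
    increases along walks, A_D becomes strictly triangular and
    det (I - A_D) takes the value 1 ([det_neq0_at_one]). *)

(** * Determinants *)

(** A permutation contributing to the determinant never decreases the rank r.
    Since it preserves the sum of all ranks, it preserves every rank, so it is
    the identity. *)
Lemma det_one_sub_ranked (K : comPzRingType) (R : realDomainType) n
    (N : 'M[K]_n) (r : 'I_n -> R) :
  (forall i j, N i j != 0 -> r i < r j) -> \det (1%:M - N) = 1.
Proof.
move=> Nr.
have entry i j : i != j -> (1%:M - N) i j != 0 -> r i < r j.
  by move=> ij; rewrite !mxE (negbTE ij) sub0r oppr_eq0; exact: Nr.
have diag i : (1%:M - N) i i = 1.
  rewrite !mxE eqxx; have [->|/Nr] := eqVneq (N i i) 0; first by rewrite subr0.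
  by rewrite ltxx.
rewrite /determinant (bigD1 (1%g : {perm (ordinal n)})) //= [X in _ + X]big1 => [|s s1].
  by rewrite odd_perm1 mul1r addr0 big1 // => i _; rewrite perm1 diag.
case: (pselect (exists i, (1%:M - N) i (s i) = 0)) => [[i si0]|no0].
  by rewrite (bigD1 i) //= si0 mul0r mulr0.
have rle i : r i <= r (s i).
  have [<-//|/eqP/eqP si] := eqVneq i (s i).
  by apply/ltW/entry => //; apply/eqP => e; apply: no0; exists i.
have sum0 : \sum_i (r (s i) - r i) = 0.
  rewrite sumrB [X in _ - X](reindex_inj (@perm_inj _ s)) /= subrr //.
have req i : r (s i) = r i.
  apply/eqP; rewrite -subr_eq0; apply/eqP.
  by have /psumr_eq0P := sum0; apply=> // j _; rewrite subr_ge0.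
case/negP: s1; apply/eqP/permP => i; rewrite perm1.
apply/eqP; rewrite eq_sym; apply/negPn/negP => si.
have := entry i (s i) si; rewrite req ltxx.
by case: eqP => [e _|_ /(_ isT)//]; apply: no0; exists i.
Qed.

(** Two orderings of the same set differ by a permutation, which changes both
    the rows and the columns. *)
Lemma det_reindex (K : comPzRingType) (S : Type) (X : set S) (F : S -> S -> K)
    n m (e : 'I_n -> S) (e' : 'I_m -> S) :
  set_bij [set: 'I_n] X e -> set_bij [set: 'I_m] X e' ->
  \det (\matrix_(i, j) F (e i) (e j)) = \det (\matrix_(i, j) F (e' i) (e' j)).
Proof.
move=> [eX einj esurj] [e'X e'inj e'surj].
have /choice[h hE] : forall i, exists k, e' k = e i.
  by move=> i; have [|k _ <-] := e'surj (e i); [exact: eX|exists k].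
have /choice[h' h'E] : forall k, exists i, e i = e' k.
  by move=> k; have [|i _ <-] := esurj (e' k); [exact: e'X|exists i].
have hK : cancel h h'.
  by move=> i; apply: einj; rewrite ?inE // h'E hE.
have h'K : cancel h' h.
  by move=> k; apply: e'inj; rewrite ?inE // hE h'E.
have nm : n = m.
  by have := bij_eq_card (Bijective hK h'K); rewrite !card_ord.
subst m; pose s := perm (can_inj hK).
have -> : \matrix_(i, j) F (e i) (e j) =
    perm_mx s *m (\matrix_(i, j) F (e' i) (e' j)) *m perm_mx s^-1.
  rewrite -row_permE -col_permE; apply/matrixP => i j.
  by rewrite !mxE !permE !hE.
by rewrite !det_mulmx !det_perm odd_permV mulrAC -signr_addb addbb mul1r.
Qed.

(** Adding the first columns times X to the last ones replaces -B by 0. *)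
Lemma det_block_eliminate (K : comPzRingType) k m (P : 'M[K]_k)
    (B : 'M[K]_(k, m)) (C : 'M[K]_(m, k)) (Q : 'M[K]_m) (X : 'M[K]_(k, m)) :
  P *m X = B ->
  \det (block_mx P (- B) (- C) Q) = \det P * \det (Q - C *m X).
Proof.
move=> PX.
have -> : \det (block_mx P (- B) (- C) Q) =
    \det (block_mx P (- B) (- C) Q *m block_mx 1%:M X 0 1%:M).
  by rewrite det_mulmx det_ublock !det1 !mulr1.
rewrite mulmx_block !mulmx1 !mulmx0 !addr0 PX subrr det_lblock.
by rewrite mulNmx addrC.
Qed.

(** * Green's functions of acyclic chains *)

Section Chains.
Context {S : choiceType} {N : markov_chain S}.
Hypotheses (fin : finite_set (states N)) (acyc : acyclic N).

Lemma walk_cons s u t w : states N s -> step N s u -> walks N u t w ->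
  walks N s t (s :: w).
Proof.
move=> Ns su [p [-> lp pp allp]]; exists (u :: p); split=> //=.
  by rewrite su.
by move=> v; rewrite inE => /orP[/eqP->//|]; exact: allp.
Qed.

(** The rank of a state is the number of states from which it can be reached:
    along a step s -> t the state t itself is gained, since without cycles t
    does not reach s. *)
Lemma acyclic_rank : exists r : S -> nat, forall s t,
  states N s -> states N t -> step N s t -> (r s < r t)%N.
Proof.
pose anc s := [set u | exists w, walks N u s w].
have financ s : finite_set (anc s).
  apply: sub_finite_set fin => u [w [p [-> _ _]]]; apply.
  by rewrite inE eqxx.
exists (fun s => #|` fset_set (anc s)|%fset) => s t Ns Nt st.
apply: fproper_ltn_card; rewrite fproperE; apply/andP; split.
  apply/fsubsetP => u; rewrite !in_fset_set // !inE => -[w [p [-> lp pp allp]]].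
  exists (u :: rcons p t), (rcons p t); split=> //.
  - by rewrite last_rcons.
  - by rewrite rcons_path pp lp.
  - by move=> v; rewrite -rcons_cons mem_rcons inE => /orP[/eqP->//|]; exact: allp.
apply/fsubsetPn; exists t; rewrite in_fset_set //.
  by rewrite inE; exists [:: t], [::]; split=> // v; rewrite inE => /eqP->.
apply/negP; rewrite inE => -[w [p [-> lp pp allp]]].
by apply: (acyc (t :: p)); split=> //=; rewrite rcons_path pp lp.
Qed.

Lemma finite_walks s t : finite_set (walks N s t).
Proof.
have [r rP] := acyclic_rank.
have [B rB] : exists B, forall u, states N u -> (r u < B)%N.
  exists (\max_(u <- fset_set (states N)) r u).+1 => u Nu.
  by rewrite ltnS; apply: leq_bigmax_seq => //; rewrite in_fset_set // inE.
have [n] := ubnP (B - r s); elim: n s => // n IHn s Brs.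
apply: (@sub_finite_set _ _ ([set [:: s]] `|`
  \bigcup_(u in [set u | [/\ states N s, states N u & step N s u]])
    (cons s @` walks N u t))).
  move=> w [[|u p] [-> lp]]; first by left.
  move=> /= /andP[su pp] allp; right.
  have Nu : states N u by apply: allp; rewrite !inE eqxx orbT.
  exists u; first by split=> //; apply: allp; rewrite inE eqxx.
  exists (u :: p) => //; exists p; split=> // v vp.
  by apply: allp; rewrite inE vp orbT.
rewrite finite_setU; split; first exact: finite_set1.
apply: bigcup_finite => [|u [Ns Nu su]].
  by apply: sub_finite_set fin => u [].
apply: finite_image; apply: IHn.
have := rP _ _ Ns Nu su; have := rB _ Nu; move: Brs.
rewrite ltnS => Brs uB su'; apply: leq_trans Brs.
by rewrite ltn_sub2l // (ltn_trans su').
Qed.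

(** A walk from s is s alone, or s followed by a walk from its second state. *)
Lemma green_first_step s t : states N s ->
  green N s t = (s == t)%:R + \sum_(u \in states N) trans N s u * green N u t.
Proof.
move=> Ns.
(* Sum over the tails of walks. A nonempty tail is a walk in F, and a walk in
   F that is not a tail starts with a state to which s makes no step, so that
   prefixing s gives it weight 0. *)
pose F := \bigcup_(u in states N) walks N u t.
have finF : finite_set F by apply: bigcup_finite => // u _; exact: finite_walks.
pose Q := [set p | walks N s t (s :: p)].
have WQ : cons s @` Q = walks N s t.
  apply/seteqP; split=> [_ [p Qp <-]//|w Ww].
  by case: (Ww) => p [ew _ _ _]; exists p => //; rewrite /Q /= -ew.
have finQ : finite_set Q.
  apply: (@sub_finite_set _ _ (behead @` walks N s t)).
    by move=> p Qp; exists (s :: p).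
  by apply: finite_image; exact: finite_walks.
rewrite /green -WQ fsbig_image; last by move=> p q _ _ [].
rewrite (fsbigID [set [::]]) //; congr (_ + _).
  have [e|st] := eqVneq s t.
    rewrite (_ : _ `&` _ = [set [::]]) ?fsbig_set1 //.
    apply/seteqP; split=> [p []//|_ ->]; split=> //.
    by exists [::]; split=> // v; rewrite inE => /eqP->.
  rewrite fsbig1 // => q [[p [[<-] lp _ _]] q0]; move: lp; rewrite q0 /=.
  by move/eqP; rewrite (negbTE st).
rewrite (fsbig_widen _ F).
- under [RHS]eq_fsbigr => u _ do rewrite mulr_fsumr.
  transitivity (\sum_(u \in states N) \sum_(w \in F)
      (if w \in walks N u t then trans N s u * weight N w else 0)).
    rewrite exchange_fsbig //; apply: eq_fsbigr => w.
    rewrite inE => -[u Nu] Wu; case: (Wu) => p [ew _ _ _].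
    rewrite (fsbigD1 u) //= mem_set // fsbig1 ?addr0 ?ew //.
    move=> v [_ /= vu]; case: ifP => //; rewrite inE => -[q []].
    by case=> /esym.
  apply: eq_fsbigr => u; rewrite inE => Nu.
  rewrite -fsbig_mkcondr setIidr // => w Wu; by exists u.
- move=> [|u p] [[q [[<-] lp pp allp]]] //= _; exists u.
    by apply: allp; rewrite !inE eqxx orbT.
  exists p; split=> //; first by case/andP: pp.
  by move=> v vp; apply: allp; rewrite inE vp orbT.
- move=> w [[u Nu Wu] nQ] /=; case: (Wu) => p [ew _ _ _].
  rewrite ew /=; have [->|su] := eqVneq (trans N s u) 0; first by rewrite mul0r.
  case: nQ; split; last by rewrite ew.
  exact: walk_cons su Wu.
Qed.

Lemma green_out s t : ~ states N s -> green N s t = 0.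
Proof.
move=> Ns; rewrite /green fsbig1 // => w [p [-> _ _]] /(_ s).
by rewrite inE eqxx => /(_ isT).
Qed.

End Chains.

(** * Contraction of abstract chains *)

Lemma finite_enumeration (S : choiceType) (X : set S) : finite_set X ->
  exists k (e : 'I_k -> S), set_bij [set: 'I_k] X e.
Proof.
move=> finX; exists #|` fset_set X|%fset, (tnth (in_tuple (fset_set X))).
split=> [i _|i j _ _|s Xs].
- have : tnth (in_tuple (fset_set X)) i \in fset_set X by exact: mem_tnth.
  by rewrite in_fset_set // inE.
- have /tuple_uniqP inj : uniq (in_tuple (fset_set X)) by exact: fset_uniq.
  by move/inj.
- have : s \in in_tuple (fset_set X) by rewrite in_fset_set // inE.
  by move/tnthP=> [i ->]; exists i.
Qed.

(** M is the whole chain, N the chain of the region to be contracted, and E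
    the set of states that survive the contraction. The last two hypotheses
    say that N can be entered from E only through In, and left to E only
    through Out. *)
Lemma det_contraction (S : choiceType) (M N : markov_chain S)
    (E In Out : set S) n m (e : 'I_n -> S) (e' : 'I_m -> S) :
  set_bij [set: 'I_n] (states M) e -> set_bij [set: 'I_m] E e' ->
  E `<=` states M -> states N `<=` states M -> states M `\` E `<=` states N ->
  acyclic N -> E `&` In `<=` states N -> E `&` Out `<=` states N ->
  (forall s, E s -> In s -> ~ Out s) ->
  (forall s t, states M s -> states M t -> ~ (E s /\ E t) ->
    trans M s t = trans N s t) ->
  (forall s t, E s -> E t -> In s -> Out t -> trans M s t = trans N s t) ->
  (forall s t, E s -> states M t -> trans N s t != 0 -> In s) ->
  (forall s t, states M s -> E t -> trans N s t != 0 -> Out t) ->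
  \det (1%:M - \matrix_(i, j) trans M (e i) (e j)) =
  \det (1%:M - \matrix_(i, j)
    (if `[< In (e' i) /\ Out (e' j) >] then green N (e' i) (e' j)
     else trans M (e' i) (e' j))).
Proof.
move=> eM e'E EM NM ME acyc InN OutN InOut M_N M_N_io enters exits.
have finM : finite_set (states M).
  have [_ _ esurj] := eM; apply: (@sub_finite_set _ _ (e @` [set: 'I_n])).
    exact: esurj.
  exact/finite_image/finite_finset.
have finN := sub_finite_set NM finM.
have [k [e0 e0I]] := finite_enumeration _ _ (sub_finite_set (@subDsetl _ _ E) finM).
have [e0_in e0_inj e0_surj] := e0I.
have [e'_in e'_inj e'_surj] := e'E.
have e0N i : states N (e0 i) by apply: ME; exact: e0_in.
have e0M i : states M (e0 i) by exact: NM.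
have e'M i : states M (e' i) by apply: EM; exact: e'_in.
have e'e i : E (e' i) by exact: e'_in.
have e0e i : ~ E (e0 i) by have [] := e0_in i.
(* An outgoing state of E is not in In, so no step of N starts there. *)
have green_outgoing v t : E v -> Out v -> green N v t = (v == t)%:R.
  move=> Ev Ov; rewrite green_first_step //; last exact: OutN.
  rewrite fsbig1 ?addr0 // => w Nw; have [->|vw] := eqVneq (trans N v w) 0.
    by rewrite mul0r.
  have Iv : In v by apply: enters vw => //; exact: NM.
  by case: (InOut _ Ev Iv).
(* In the first-step equation, the only state of E that can be stepped to and
   still reach t is t itself; so only a single step and the interior remain. *)
have green_step s t : states N s -> E t -> Out t ->
    green N s t = (s == t)%:R + trans N s t +
      \sum_i trans N s (e0 i) * green N (e0 i) t.
  move=> Ns Et Ot; rewrite green_first_step // -addrA; congr (_ + _).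
  rewrite (fsbig_widen _ (states M)) //; last first.
    by move=> u [_ Nu] /=; rewrite green_out // mulr0.
  rewrite (fsbigID E) //; congr (_ + _).
    rewrite (fsbigD1 t) //=; last 2 first.
      exact: finite_setIl.
      by split=> //; exact: EM.
    rewrite green_outgoing // eqxx mulr1 fsbig1 ?addr0 // => v [[Mv Ev] /= vt].
    have [->|sv] := eqVneq (trans N s v) 0; first by rewrite mul0r.
    rewrite green_outgoing //; last by apply: exits sv => //; exact: NM.
    by case: eqP => // _; rewrite mulr0.
  rewrite -setDE (reindex_fsbig _ _ _ _ e0I) -[RHS]big_enum /=.
  by rewrite [RHS]fsbig_seq ?enum_uniq //; apply: eq_fsbigl; apply/seteqP; split=> i // _;
    rewrite /= mem_enum.
pose F s t : ZT := (s == t)%:R - trans M s t.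
pose e'' (i : ordinal (k + m)) := match fintype.split i with inl a => e0 a | inr b => e' b end.
have e''M : set_bij [set: 'I_(k + m)] (states M) e''.
  split.
  - by move=> i _; rewrite /e''; case: fintype.split.
  - move=> i j _ _; rewrite /e'' -{2}(splitK i) -{2}(splitK j).
    case: (fintype.split i) (fintype.split j) => a [] b eab.
    + by congr unsplit; congr inl; apply: e0_inj; rewrite ?inE.
    + by have := e0e a; rewrite eab; case; exact: e'e.
    + by have := e0e b; rewrite -eab; case; exact: e'e.
    + by congr unsplit; congr inr; apply: e'_inj; rewrite ?inE.
  - move=> s Ms; have [Es|nEs] := pselect (E s).
      have [b _ <-] := e'_surj s Es.
      by exists (unsplit (inr b)) => //; rewrite /e'' unsplitK.
    have [a _ <-] := e0_surj s (conj Ms nEs).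
    by exists (unsplit (inl a)) => //; rewrite /e'' unsplitK.
have [_ e_inj _] := eM.
rewrite (_ : 1%:M - _ = \matrix_(i, j) F (e i) (e j)); last first.
  apply/matrixP => i j; rewrite !mxE /F; congr (_%:R - _); congr nat_of_bool.
  by apply/eqP/eqP => [->//|]; apply: e_inj; rewrite inE.
rewrite (det_reindex _ _ _ _ _ _ _ _ eM e''M).
pose A0 := \matrix_(i < k, j < k) trans M (e0 i) (e0 j).
pose B := \matrix_(i < k, j < m) trans M (e0 i) (e' j).
pose C := \matrix_(i < m, j < k) trans M (e' i) (e0 j).
pose A1 := \matrix_(i < m, j < m) trans M (e' i) (e' j).
pose X := \matrix_(i < k, j < m)
  (if `[< Out (e' j) >] then green N (e0 i) (e' j) else 0).
rewrite (_ : \matrix_(i, j) _ = block_mx (1%:M - A0) (- B) (- C) (1%:M - A1)); last first.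
  apply/matrixP => i j; rewrite !mxE /F /e''.
  case: (fintype.split i) => a; rewrite !mxE; case: (fintype.split j) => b; rewrite !mxE.
  - congr (_%:R - _); congr nat_of_bool.
    by apply/eqP/eqP => [|->//]; apply: e0_inj; rewrite inE.
  - case: eqP => [ab|_]; last by rewrite sub0r.
    by have := e0e a; rewrite ab; case; exact: e'e.
  - case: eqP => [ab|_]; last by rewrite sub0r.
    by have := e0e b; rewrite -ab; case; exact: e'e.
  - congr (_%:R - _); congr nat_of_bool.
    by apply/eqP/eqP => [|->//]; apply: e'_inj; rewrite inE.
have A0N a b : trans M (e0 a) (e0 b) = trans N (e0 a) (e0 b).
  by apply: M_N => // -[/e0e].
have BN a b : trans M (e0 a) (e' b) = trans N (e0 a) (e' b).
  by apply: M_N => // -[/e0e].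
have CN a b : trans M (e' a) (e0 b) = trans N (e' a) (e0 b).
  by apply: M_N => // -[_ /e0e].
rewrite (@det_block_eliminate _ _ _ _ _ _ _ X); last first.
  apply/matrixP => i j; rewrite mulmxBl mul1mx !mxE BN.
  case: asboolP => Oj.
    rewrite green_step //.
    case: eqP => [ij|_]; first by have := e0e i; rewrite ij; case; exact: e'e.
    rewrite add0r; apply/eqP; rewrite subr_eq; apply/eqP; congr (_ + _).
    by apply: eq_bigr => l _; rewrite !mxE A0N asboolT.
  rewrite sub0r big1 ?oppr0 => [|l _]; last by rewrite !mxE asboolF // mulr0.
  by have [//|ij] := eqVneq (trans N (e0 i) (e' j)) 0; case: Oj; apply: exits ij.
have [r rP] := acyclic_rank finN acyc.
rewrite (@det_one_sub_ranked _ int _ _ (fun i => (r (e0 i))%:Z)); last first.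
  by move=> i j; rewrite mxE A0N ltz_nat => ij; apply: rP.
rewrite mul1r; congr (\det _); apply/matrixP => i j; rewrite !mxE -addrA -opprD.
congr (_ - _).
have [Oj|nOj] := pselect (Out (e' j)); last first.
  rewrite asboolF; last by case.
  by rewrite big1 ?addr0 // => l _; rewrite !mxE asboolF // mulr0.
have [Ii|nIi] := pselect (In (e' i)); last first.
  rewrite asboolF; last by case.
  rewrite big1 ?addr0 // => l _; rewrite !mxE CN.
  have [->|il] := eqVneq (trans N (e' i) (e0 l)) 0; first by rewrite mul0r.
  by case: nIi; apply: enters il.
rewrite asboolT // green_step //; last exact: InN.
case: eqP => [ij|_].
  by case: (InOut _ (e'e i) Ii); rewrite ij.
rewrite add0r M_N_io //; congr (_ + _); apply: eq_bigr => l _.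
by rewrite !mxE CN asboolT.
Qed.

(** * Specialization at T = 1 *)

(** The transition functions of a diagram have a pole only at T = 0, and at
    most a simple one, so multiplication by T turns them into polynomials. *)
Definition value_at_one (v : ZT) (c : int) : Prop :=
  exists2 p : {poly int}, varT * v = tofrac p & p.[1] = c.

Lemma varT_neq0 : varT != 0.
Proof. by rewrite /varT tofrac_eq0 polyX_eq0. Qed.

Lemma value_at_one0 : value_at_one 0 0.
Proof. by exists 0; rewrite ?mulr0 ?tofrac0 ?horner0. Qed.

Lemma value_at_one1 : value_at_one 1 1.
Proof. by exists 'X; rewrite ?mulr1 ?hornerX. Qed.

Lemma value_at_oneB u v c d : value_at_one u c -> value_at_one v d ->
  value_at_one (u - v) (c - d).
Proof.
move=> [p pu <-] [q qv <-]; exists (p - q).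
  by rewrite mulrBr pu qv tofracB.
by rewrite hornerD hornerN.
Qed.

Lemma value_at_one_sign (R : realDomainType) (a : R) :
  value_at_one (varT ^ sgz a) 1.
Proof.
case: sgzP => _.
- exact: value_at_one1.
- by exists ('X ^+ 2); rewrite ?hornerXn ?expr1n // expr2 tofracM expr1z.
- by exists 1; rewrite ?hornerC // exprN1 divff ?varT_neq0 ?tofrac1.
Qed.

(** The determinant of T(I - A) is a polynomial with value 1 at T = 1. *)
Lemma det_neq0_at_one (R : realDomainType) n (A : 'M[ZT]_n) (r : 'I_n -> R) :
  (forall i j, exists2 c, value_at_one (A i j) c & c != 0 -> r i < r j) ->
  \det (1%:M - A) != 0.
Proof.
move=> Ar.
have /choice[P PA] : forall ij : 'I_n * 'I_n, exists p : {poly int},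
    varT * A ij.1 ij.2 = tofrac p /\ (p.[1] != 0 -> r ij.1 < r ij.2).
  by move=> [i j]; have [c [p pA <-] rij] := Ar i j; exists p.
pose Q := \matrix_(i < n, j < n) P (i, j).
have QA : map_mx (@tofrac _) ('X%:M - Q) = varT *: (1%:M - A).
  apply/matrixP => i j; rewrite !mxE tofracB mulrBr -(PA (i, j)).1.
  by case: eqP; rewrite ?mulr0 ?mulr1 ?mulr1n ?mulr0n ?tofrac0.
have det_at1 : (\det ('X%:M - Q)).[1] = 1.
  rewrite -[LHS]/(horner_eval 1 _) -det_map_mx.
  rewrite -[RHS](@det_one_sub_ranked _ _ _ (map_mx (horner_eval 1) Q) r); last first.
    by move=> i j; rewrite !mxE /horner_eval; exact: (PA (i, j)).2.
  congr (\det _); apply/matrixP => i j; rewrite !mxE /= /horner_eval hornerD hornerN.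
  by case: eqP; rewrite ?mulr1n ?mulr0n ?hornerX ?horner0.
apply/eqP => det0.
have /eqP : tofrac (\det ('X%:M - Q)) = 0.
  by rewrite -det_map_mx QA detZ det0 mulr0.
by rewrite tofrac_eq0 => /eqP Q0; move: det_at1; rewrite Q0 horner0.
Qed.

(** * Connected sets and derivatives *)

Lemma connected_closed_cover (T : topologicalType) (C K1 K2 : set T) :
  connected C -> closed K1 -> closed K2 -> C `<=` K1 `|` K2 ->
  C `&` (K1 `&` K2) = set0 -> C `<=` K1 \/ C `<=` K2.
Proof.
move=> Cconn K1c K2c CK CK0.
suff : C `<=` C `&` K1 \/ C `<=` C `&` K2.
  by case=> H; [left|right] => x /H[].
apply: connected_subset => //; last first.
  by move=> x Cx; case: (CK x Cx); [left|right].
have clI K : closed K -> closure (C `&` K) `<=` K.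
  by move=> /closure_id Kc; rewrite [X in _ `<=` X]Kc; apply: closureS.
split; apply/seteqP; split=> // x.
- by move=> [/(clI _ K1c) K1x [Cx K2x]]; rewrite -CK0.
- by move=> [[Cx K1x] /(clI _ K2c) K2x]; rewrite -CK0.
Qed.

Lemma connected_meets_frontier (R : realType) (C X : set (plane R)) :
  connected C -> closed X -> C `&` X !=set0 -> ~ C `<=` X ->
  C `&` frontier X !=set0.
Proof.
move=> Cconn Xc [p [Cp Xp]] nCX; apply/set0P/eqP => C0.
have [//|CnX] : C `<=` X \/ C `<=` ~` X°.
- apply: connected_closed_cover => //.
    by apply: open_closedC; exact: open_interior.
  move=> q _; have [|] := pselect (X q); first by left.
  by move=> nXq; right => /interior_subset.
- have : (C `&` frontier X) p by split=> //; split=> //; exact: CnX.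
  by rewrite C0.
Qed.

(** The difference quotient of g at t is positive near t. *)
Lemma derive_gt0_monotone_near (R : realType) (g : R -> R) (t : R) :
  derivable g t 1 -> 0 < 'D_1 g t ->
  (\forall u \near t^'+, g t < g u) /\ (\forall u \near t^'-, g u < g t).
Proof.
move=> dg dpos.
have : \forall h \near 0^', 0 < h^-1 *: (g (h *: 1 + t) - g t) :> R.
  exact: (@cvgr_gt _ _ _ _ _ _ dg _ dpos).
case=> e /= e0 He; have Hu u : `|u - t| < e -> u != t -> 0 < (u - t)^-1 * (g u - g t).
  move=> ue ut; have := He (u - t); rewrite /= subr_eq0 /ball /= sub0r normrN.
  by move=> /(_ ue ut); rewrite /GRing.scale /= mulr1 subrK.
split.
- near=> u.
  have tu : t < u by near: u; exact: nbhs_right_gt.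
  have := Hu u; rewrite ger0_norm ?subr_ge0 ?ltW // (gt_eqF tu) => /(_ _ isT).
  rewrite pmulr_rgt0 ?invr_gt0 ?subr_gt0 //; apply.
  by rewrite ltrBlDl; near: u; apply: nbhs_right_lt; rewrite ltrDl.
- near=> u.
  have tu : u < t by near: u; exact: nbhs_left_lt.
  have := Hu u; rewrite distrC ger0_norm ?subr_ge0 ?ltW // (lt_eqF tu) => /(_ _ isT).
  rewrite nmulr_rgt0 ?invr_lt0 ?subr_lt0 //; apply.
  by rewrite ltrBlDr -ltrBlDl; near: u; apply: nbhs_left_gt; rewrite ltrBlDr ltrDl.
Unshelve. all: by end_near.
Qed.

(** * Strands are arcs *)

Section Strands.
Context {R : realType} {Sigma : set (plane R)} {D : tangle_diagram Sigma}.
Implicit Types (x y z w : 'I_(ncomp D) * R) (s X B : set (plane R)).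

Lemma curve_differentiable (i : 'I_(ncomp D)) (t : R) :
  differentiable (curve i) t.
Proof. by apply/derivable1_diffP; have [] := curve_C1 i. Qed.

Lemma curve_continuous (i : 'I_(ncomp D)) : continuous (curve i).
Proof. by move=> t; apply: differentiable_continuous; exact: curve_differentiable. Qed.

Lemma segment_image_connected (i : 'I_(ncomp D)) (a b : R) :
  connected (curve i @` `[a, b]).
Proof.
apply: connected_continuous_connected; first exact: segment_connected.
by apply: continuous_subspaceT; exact: curve_continuous.
Qed.

Lemma segment_image_closed (i : 'I_(ncomp D)) (a b : R) :
  closed (curve i @` `[a, b]).
Proof.
apply: compact_closed; first exact: norm_hausdorff.
apply: continuous_compact; last exact: segment_compact.
by apply: continuous_subspaceT; exact: curve_continuous.
Qed.

Lemma crossing_height x y : params x -> params y -> x <> y -> pt x = pt y ->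
  crossing_points D (pt x).
Proof.
move=> Px Py xy exy.
have [hxy|hyx|hxy] := ltgtP (pt_height x) (pt_height y).
- by exists y, x; split; [split; rewrite ?exy|].
- by exists x, y; split.
- by case: xy; exact: embedding.
Qed.

Lemma crossing_pointsP x : params x -> crossing_points D (pt x) ->
  exists2 y, params y /\ x <> y & pt x = pt y.
Proof.
move=> Px [y [z [[Py Pz eyz hyz] eyx]]].
have [xy|xy] := pselect (x = y).
  exists z; last by rewrite -eyx.
  by split=> // xz; move: hyz; rewrite -xy -xz ltxx.
by exists y.
Qed.

Lemma regular_inj x y : params x -> params y -> pt x = pt y ->
  ~ crossing_points D (pt x) -> x = y.
Proof. by move=> Px Py exy nc; apply: contra_notP nc => /crossing_height; exact. Qed.

Definition regular_points X : set (plane R) :=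
  (@pt _ _ D @` @params _ _ D `&` X) `\` crossing_points D.

Lemma strands_ofP X s : strands_of D X s ->
  [/\ s !=set0, s `<=` regular_points X, connected s &
   forall B, connected B -> B `<=` regular_points X -> B `&` s !=set0 -> B `<=` s].
Proof.
move=> [p Ap <-]; split.
- by exists p; exact: connected_component_refl.
- exact: connected_component_sub.
- exact: component_connected.
- move=> B Bc BA [q [Bq sq]].
  by rewrite (same_connected_component sq); exact: connected_component_max.
Qed.

(** The strands of a subdiagram are thus identified with the strands of D
    that meet the region. *)
Lemma substrandsP X s : X `<=` Sigma ->
  substrands D X s <-> strands D s /\ s `&` X !=set0.
Proof.
move=> XS; split.
  move=> [Ds [s' s'X s's]]; split=> //.
  have [[p s'p] s'A _ _] := strands_ofP _ _ s'X.
  by exists p; split; [exact: s's|have [[]] := s'A p s'p].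
move=> [Ds [p [sp Xp]]]; split=> //.
have [_ sA _ smax] := strands_ofP _ _ Ds.
have Ap : regular_points X p by have [[Ip _] nc] := sA p sp.
exists (connected_component (regular_points X) p); first by exists p.
apply: smax; first exact: component_connected.
  move=> q /connected_component_sub[[Iq Xq] nc].
  by split=> //; split=> //; exact: XS.
by exists p; split=> //; exact: connected_component_refl.
Qed.

Lemma strand_param s p : strands D s -> s p -> exists2 x : 'I_(ncomp D) * R, params x & pt x = p.
Proof. by move=> /strands_ofP[_ sA _ _] /sA[[[x Px <-]]]; exists x. Qed.

Lemma strand_regular s p : strands D s -> s p -> ~ crossing_points D p.
Proof. by move=> /strands_ofP[_ sA _ _] /sA[]. Qed.

Lemma strand_inj s x y : strands D s -> s (pt x) -> params x -> params y ->
  pt x = pt y -> x = y.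
Proof. by move=> Ds sx Px Py exy; apply: regular_inj => //; exact: strand_regular sx. Qed.

Hypothesis no_closed : no_closed_component D.

Lemma params_segment x : params x <-> 0 <= x.2 <= 1.
Proof.
rewrite /params /parameters /= (negbTE (no_closed x.1)).
by split=> [[-> ->]|/andP[]].
Qed.

Lemma itv_params (i : 'I_(ncomp D)) (t : R) : `[0, 1]%classic t -> params (i, t).
Proof. by rewrite /= in_itv /= => t01; apply/params_segment. Qed.

Lemma crossing_interior x : params x -> crossing_points D (pt x) -> 0 < x.2 < 1.
Proof.
move=> Px cx; have [y [Py xy] exy] := crossing_pointsP _ Px cx.
have nf := double_points_interior Px Py xy exy.
have /andP[x0 x1] := (params_segment x).1 Px.
rewrite !lt_neqAle x0 x1 !andbT; apply/andP; split; apply/eqP => e; apply: nf;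
  apply/(properness Px); split; try exact: no_closed; by [left|right].
Qed.

Definition other_components (i : 'I_(ncomp D)) : set (plane R) :=
  \bigcup_(j in [set j | j <> i]) (curve j @` `[0, 1]).

Lemma other_components_closed i : closed (other_components i).
Proof.
apply: closed_bigcup; first exact: finite_finset.
by move=> j _; exact: segment_image_closed.
Qed.

(** The image of one component and that of all the others are closed and meet
    only in crossings, so they separate the strands. *)
Lemma strand_component s x y : strands D s -> params x -> params y ->
  s (pt x) -> s (pt y) -> x.1 = y.1.
Proof.
move=> Ds Px Py sx sy.
have [_ sA sconn _] := strands_ofP _ _ Ds.
have [] := @connected_closed_cover _ s (curve x.1 @` `[0, 1]) (other_components x.1).
- exact: sconn.
- exact: segment_image_closed.
- exact: other_components_closed.
- move=> p sp; have [z Pz <-] := strand_param _ _ Ds sp.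
  have z01 := (params_segment z).1 Pz.
  have [zx|zx] := pselect (z.1 = x.1).
    by left; exists z.2; rewrite /= ?in_itv //= -zx.
  by right; exists z.1 => //; exists z.2; rewrite /= ?in_itv.
- apply/seteqP; split=> // p [sp [[t t01 etp] [j jx [u u01 eup]]]].
  have := @strand_inj s (x.1, t) (j, u) Ds; rewrite /pt /= etp eup.
  move=> /(_ sp (itv_params _ _ t01) (itv_params _ _ u01) erefl)[xj _].
  by case: jx.
- move=> /(_ _ sy)[t t01 ety].
  by rewrite (strand_inj _ _ (x.1, t) Ds sy Py) //; exact: itv_params.
- move=> /(_ _ sx)[j jx [t t01 ety]].
  case: jx; rewrite (strand_inj _ _ (j, t) Ds sx Px) //.
  exact: itv_params.
Qed.

(** Cut the component at v: what precedes v, and what follows v together with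
    the other components, are closed pieces of the diagram that meet only in
    crossings, the point at v being itself one. A strand lies in one piece,
    but x and y would lie in different ones. *)
Lemma strand_no_crossing s x y (v : R) : strands D s -> params x -> params y ->
  s (pt x) -> s (pt y) -> x.2 <= v <= y.2 ->
  ~ crossing_points D (curve x.1 v).
Proof.
move=> Ds Px Py sx sy /andP[xv vy] cv.
have xy := strand_component _ _ _ Ds Px Py sx sy.
have /andP[x0 x1] := (params_segment x).1 Px.
have /andP[y0 y1] := (params_segment y).1 Py.
have nx := strand_regular _ _ Ds sx; have ny := strand_regular _ _ Ds sy.
have [_ sA sconn _] := strands_ofP _ _ Ds.
have P0v t : `[0, v]%classic t -> params (x.1, t).
  rewrite /= in_itv /= => /andP[t0 tv]; apply/params_segment.
  by rewrite /= t0 (le_trans tv) // (le_trans vy).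
have Pv1 t : `[v, 1]%classic t -> params (x.1, t).
  rewrite /= in_itv /= => /andP[vt t1]; apply/params_segment.
  by rewrite /= t1 andbT (le_trans _ vt) // (le_trans x0).
have [] := @connected_closed_cover _ s (curve x.1 @` `[0, v])
    (curve x.1 @` `[v, 1] `|` other_components x.1).
- exact: sconn.
- exact: segment_image_closed.
- by apply: closedU; [exact: segment_image_closed|exact: other_components_closed].
- move=> p sp; have [z Pz <-] := strand_param _ _ Ds sp.
  have /andP[z0 z1] := (params_segment z).1 Pz.
  have [zx|zx] := pselect (z.1 = x.1); last first.
    right; right; exists z.1 => //; exists z.2; rewrite /= ?in_itv //=.
    by rewrite z0.
  have [zv|vz] := leP z.2 v.
    by left; exists z.2; rewrite /pt -?zx //= in_itv /= z0.
  by right; left; exists z.2; rewrite /pt -?zx //= in_itv /= z1 ltW.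
- apply/seteqP; split=> // p [sp [[t t0v etp] K2p]].
  have stp : s (pt (x.1, t)) by rewrite /pt /= etp.
  case: K2p => [[u uv1 eup]|[j jx [u u01 eup]]].
    have := strand_inj _ _ (x.1, u) Ds stp (P0v _ t0v) (Pv1 _ uv1).
    rewrite /pt /= etp eup => /(_ erefl)[tu].
    have tv : t = v.
      apply/eqP; rewrite eq_le; move: t0v uv1; rewrite /= !in_itv /= tu.
      by move=> /andP[_ ->] /andP[->].
    by apply: (strand_regular _ _ Ds sp); rewrite -etp tv.
  have := strand_inj _ _ (j, u) Ds stp (P0v _ t0v) (itv_params _ _ u01).
  by rewrite /pt /= etp eup => /(_ erefl)[xj _]; case: jx.
- move=> /(_ _ sy)[t t0v ety]; apply: ny.
  rewrite (_ : pt y = curve x.1 v) //.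
  have := strand_inj _ _ (x.1, t) Ds sy Py (P0v _ t0v).
  rewrite {2}/pt /= ety => /(_ erefl) yt; rewrite -ety; congr (curve _ _).
  move: t0v vy; have -> : y.2 = t by rewrite yt.
  rewrite /= in_itv /= => /andP[_ tv] vt.
  by apply/eqP; rewrite eq_le tv.
- move=> /(_ _ sx)[[t tv1 etx]|[j jx [t t01 etx]]].
    apply: nx; rewrite (_ : pt x = curve x.1 v) //.
    have := strand_inj _ _ (x.1, t) Ds sx Px (Pv1 _ tv1).
    rewrite {2}/pt /= etx => /(_ erefl) xt; rewrite -etx; congr (curve _ _).
    move: tv1 xv; have -> : x.2 = t by rewrite xt.
    rewrite /= in_itv /= => /andP[vt _] tv.
    by apply/eqP; rewrite eq_le tv.
  have := strand_inj _ _ (j, t) Ds sx Px (itv_params _ _ t01).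
  by rewrite {2}/pt /= etx => /(_ erefl) xj; case: jx; rewrite xj.
Qed.

(** The image of [x.2, y.2] is connected and free of crossings. *)
Lemma strand_arc s x y (u : R) : strands D s -> params x -> params y ->
  s (pt x) -> s (pt y) -> x.2 <= u <= y.2 -> s (curve x.1 u).
Proof.
move=> Ds Px Py sx sy xuy.
have /andP[x0 _] := (params_segment x).1 Px.
have /andP[_ y1] := (params_segment y).1 Py.
have [_ sA sconn smax] := strands_ofP _ _ Ds.
apply: (smax (curve x.1 @` `[x.2, y.2])).
- exact: segment_image_connected.
- move=> _ [v + <-]; rewrite /= in_itv /= => xvy; split; last first.
    exact: strand_no_crossing Py sx sy xvy.
  have Pv : params (x.1, v).
    apply/params_segment; case/andP: xvy => xv vy /=.
    by rewrite (le_trans x0) //= (le_trans vy).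
  by split; [exists (x.1, v)|exact: (pt_in Pv)].
- exists (pt x); split=> //; exists x.2 => //=.
  by rewrite in_itv /= lexx; case/andP: xuy; exact: le_trans.
- by exists u.
Qed.

Lemma arrives_witness s z (b : R) : arrives s z -> b < z.2 ->
  exists2 u, b < u < z.2 & s (curve z.1 u).
Proof.
move=> sz bz; near (z.2^'-) => u; exists u; last by near: u.
by apply/andP; split; near: u; [exact: nbhs_left_gt|exact: nbhs_left_lt].
Unshelve. all: by end_near.
Qed.

Lemma leaves_witness s z (b : R) : leaves s z -> z.2 < b ->
  exists2 u, z.2 < u < b & s (curve z.1 u).
Proof.
move=> sz bz; near (z.2^'+) => u; exists u; last by near: u.
by apply/andP; split; near: u; [exact: nbhs_right_gt|exact: nbhs_right_lt].
Unshelve. all: by end_near.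
Qed.

(** A strand ends where it arrives: its parameters fill the time between any
    of its points and the crossing. *)
Lemma arrives_after s z w : strands D s -> params z -> crossing_points D (pt z) ->
  arrives s z -> params w -> s (pt w) ->
  [/\ w.1 = z.1, w.2 < z.2 & forall u, w.2 <= u < z.2 -> s (curve w.1 u)].
Proof.
move=> Ds Pz cz sz Pw sw; have /andP[z0 z1] := crossing_interior _ Pz cz.
have Pzu u : 0 < u < z.2 -> params (z.1, u).
  move=> /andP[u0 uz]; apply/params_segment.
  by rewrite /= ltW // ltW // (lt_trans uz).
have [u0 u0z su0] := arrives_witness _ _ _ sz z0.
have wz := strand_component _ _ (z.1, u0) Ds Pw (Pzu _ u0z) sw su0.
have wz2 : w.2 < z.2.
  rewrite ltNge; apply/negP => zw.
  apply: (strand_no_crossing _ (z.1, u0) w z.2 Ds (Pzu _ u0z) Pw su0 sw) => //.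
  by rewrite /= zw andbT; case/andP: u0z => _ /ltW.
split=> // u /andP[wu uz].
have [v /andP[uv vz] sv] := arrives_witness _ _ _ sz uz.
have /andP[w0 _] := (params_segment w).1 Pw.
apply: (strand_arc _ w (z.1, v) u Ds Pw) => //; last by rewrite wu ltW.
by apply: Pzu; rewrite vz andbT (le_lt_trans _ uv) // (le_trans w0).
Qed.

Lemma leaves_before s z w : strands D s -> params z -> crossing_points D (pt z) ->
  leaves s z -> params w -> s (pt w) ->
  [/\ w.1 = z.1, z.2 < w.2 & forall u, z.2 < u <= w.2 -> s (curve w.1 u)].
Proof.
move=> Ds Pz cz sz Pw sw; have /andP[z0 z1] := crossing_interior _ Pz cz.
have Pzu u : z.2 < u < 1 -> params (z.1, u).
  move=> /andP[zu u1]; apply/params_segment.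
  by rewrite /= (ltW u1) andbT ltW // (lt_trans z0).
have [u0 u0z su0] := leaves_witness _ _ _ sz z1.
have wz : w.1 = z.1 := strand_component _ _ (z.1, u0) Ds Pw (Pzu _ u0z) sw su0.
have wz2 : z.2 < w.2.
  rewrite ltNge; apply/negP => zw.
  apply: (strand_no_crossing _ w (z.1, u0) z.2 Ds Pw (Pzu _ u0z) sw su0).
    by rewrite zw /=; case/andP: u0z => /ltW.
  by rewrite wz.
split=> // u /andP[zu uw].
have [v /andP[zv vu] sv] := leaves_witness _ _ _ sz zu.
have /andP[_ w1] := (params_segment w).1 Pw.
rewrite wz; apply: (strand_arc _ (z.1, v) w u Ds _ Pw) => //.
  by apply: Pzu; rewrite zv (lt_le_trans vu) // (le_trans uw).
by rewrite /= uw ltW.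
Qed.

End Strands.

(** * Strands crossing the frontier of a surface *)

Section Frontier.
Context {R : realType} {Sigma : set (plane R)} {D : tangle_diagram Sigma}.
Implicit Types (x y z w : 'I_(ncomp D) * R) (s : set (plane R)).
Hypothesis no_closed : no_closed_component D.
Context {U : set (plane R)}.

(** Reduces the position of the curve relative to U near a frontier point to
    the sign of a function of one variable, with known derivative. *)
Lemma defining_function_along_curve w f : defining_function U (pt w) f ->
  [/\ f (curve w.1 w.2) = 0, derivable (f \o curve w.1) w.2 1,
      'D_1 (f \o curve w.1) w.2 = 'd f (pt w) (pt_velocity w) &
      \forall u \near w.2, U (curve w.1 u) <-> 0 <= f (curve w.1 u)].
Proof.
move=> [fw f_C1 _ fU].
have df : differentiable f (pt w) by have [] := nbhs_singleton f_C1.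
have dc := curve_differentiable w.1 w.2.
have dfc : differentiable (f \o curve w.1) w.2 by exact: differentiable_comp.
split=> //.
- exact: diff_derivable.
- by rewrite deriveE // diff_comp //= /pt_velocity derive1E'.
- exact: (curve_continuous w.1 w.2 _ fU).
Qed.

Lemma curve_enters w f : defining_function U (pt w) f ->
  0 < 'd f (pt w) (pt_velocity w) ->
  (\forall u \near w.2^'+, U (curve w.1 u)) /\
  (\forall u \near w.2^'-, ~ U (curve w.1 u)).
Proof.
move=> /defining_function_along_curve[f0 fd <- fU].
move=> /(derive_gt0_monotone_near _ _ _ fd)[gr gl].
split; near=> u.
- have [_] : U (curve w.1 u) <-> 0 <= f (curve w.1 u).
    by near: u; apply: cvg_within.
  by apply; rewrite -f0 ltW //; near: u.
- have [Uf _] : U (curve w.1 u) <-> 0 <= f (curve w.1 u).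
    by near: u; apply: cvg_within.
  by apply/(contra_not Uf)/negP; rewrite -ltNge -f0; near: u.
Unshelve. all: by end_near.
Qed.

Lemma curve_exits w f : defining_function U (pt w) f ->
  'd f (pt w) (pt_velocity w) < 0 ->
  (\forall u \near w.2^'+, ~ U (curve w.1 u)) /\
  (\forall u \near w.2^'-, U (curve w.1 u)).
Proof.
move=> /defining_function_along_curve[f0 fd <- fU].
rewrite -oppr_gt0 -deriveN //.
move=> /(derive_gt0_monotone_near _ _ _ (derivableN fd))[gr gl].
split; near=> u.
- have [Uf _] : U (curve w.1 u) <-> 0 <= f (curve w.1 u).
    by near: u; apply: cvg_within.
  by apply/(contra_not Uf)/negP; rewrite -ltNge -f0 -ltrN2; near: u.
- have [_] : U (curve w.1 u) <-> 0 <= f (curve w.1 u).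
    by near: u; apply: cvg_within.
  by apply; rewrite -f0 -lerN2 ltW //; near: u.
Unshelve. all: by end_near.
Qed.

Hypotheses (U_surface : compact_surface U) (U_transverse : transverse_to D U).
Hypothesis U_avoids : frontier U `&` crossing_points D = set0.
Hypothesis meet_once :
  forall s, strands D s -> is_subset1 (s `&` frontier U).

Lemma surface_closed : closed U.
Proof.
by have [Uc _] := U_surface; apply: compact_closed => //; exact: norm_hausdorff.
Qed.

Lemma transverse_crossing w : params w -> frontier U (pt w) ->
  exists2 f, defining_function U (pt w) f & 'd f (pt w) (pt_velocity w) != 0.
Proof.
move=> Pw Fw; have [_ /(_ _ Fw)[f Uf]] := U_surface; exists f => //.
by apply/eqP => df0; apply: (U_transverse _ Pw Fw); exists f.
Qed.

Lemma crossing_near_inside z : crossing_points D (pt z) -> U (pt z) ->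
  \forall u \near z.2, U (curve z.1 u).
Proof.
move=> cz Uz; have Uz0 : U° (pt z).
  apply/not_notP => nUz.
  have : (frontier U `&` crossing_points D) (pt z) by split.
  by rewrite U_avoids.
exact: (curve_continuous z.1 z.2 _ Uz0).
Qed.

(** Otherwise the connected image of [a, b] would meet the frontier of U at a
    second point of the strand. *)
Lemma strand_one_side s w (a b : R) : strands D s -> params w -> s (pt w) ->
  frontier U (pt w) -> 0 <= a -> b <= 1 -> ~~ (a <= w.2 <= b) ->
  (forall u, a <= u <= b -> s (curve w.1 u)) ->
  a <= b -> U (curve w.1 a) <-> U (curve w.1 b).
Proof.
move=> Ds Pw sw Fw a0 b1 wab sab ab.
have stays : curve w.1 @` `[a, b] `&` U !=set0 -> curve w.1 @` `[a, b] `<=` U.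
  move=> abU; apply/not_notP => nabU.
  have [|q [[u + eq] Fq]] := connected_meets_frontier _ _ _ _ surface_closed abU nabU.
    exact: segment_image_connected.
  rewrite /= in_itv /= => aub; have su := sab _ aub.
  have Pu : params (w.1, u).
    apply/(params_segment no_closed); case/andP: aub => au ub.
    by rewrite /= (le_trans a0) //= (le_trans ub).
  have wu : w = (w.1, u).
    apply: (strand_inj _ _ _ Ds sw Pw Pu); apply: (meet_once _ Ds); split=> //.
    by rewrite /pt /= eq.
  by case/negP: wab; rewrite wu.
have mem u : a <= u <= b -> (curve w.1 @` `[a, b]) (curve w.1 u).
  by move=> aub; exists u; rewrite //= in_itv.
split=> Uu; apply: stays; try by apply: mem; rewrite ?lexx ?ab.
- by exists (curve w.1 a); split=> //; apply: mem; rewrite lexx.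
- by exists (curve w.1 b); split=> //; apply: mem; rewrite lexx ab.
Qed.

Lemma strand_side_after s w (c : R) : strands D s -> params w -> s (pt w) ->
  frontier U (pt w) -> w.2 < c -> c <= 1 ->
  (forall u, w.2 <= u < c -> s (curve w.1 u)) ->
  \forall a \near w.2^'+, \forall b \near c^'-,
    U (curve w.1 a) <-> U (curve w.1 b).
Proof.
move=> Ds Pw sw Fw wc c1 sarc; have /andP[w0 _] := (params_segment no_closed w).1 Pw.
near=> a; near=> b.
have wa : w.2 < a by near: a; exact: nbhs_right_gt.
have bc : b < c by near: b; exact: nbhs_left_lt.
have ab : a < b.
  by near: b; apply: nbhs_left_gt; near: a; exact: nbhs_right_lt.
apply: (strand_one_side s w) => //; last exact: ltW.
- exact/ltW/(le_lt_trans _ wa).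
- exact/ltW/(lt_le_trans bc).
- by rewrite negb_and -!ltNge wa.
- move=> u /andP[au ub]; apply: sarc.
  by rewrite (le_trans _ au) ?ltW //= (le_lt_trans ub).
Unshelve. all: by end_near.
Qed.

Lemma strand_side_before s w (c : R) : strands D s -> params w -> s (pt w) ->
  frontier U (pt w) -> c < w.2 -> 0 <= c ->
  (forall u, c < u <= w.2 -> s (curve w.1 u)) ->
  \forall b \near w.2^'-, \forall a \near c^'+,
    U (curve w.1 a) <-> U (curve w.1 b).
Proof.
move=> Ds Pw sw Fw cw c0 sarc; have /andP[_ w1] := (params_segment no_closed w).1 Pw.
near=> b; near=> a.
have bw : b < w.2 by near: b; exact: nbhs_left_lt.
have ca : c < a by near: a; exact: nbhs_right_gt.
have ab : a < b.
  by near: a; apply: nbhs_right_lt; near: b; exact: nbhs_left_gt.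
apply: (strand_one_side s w) => //; last exact: ltW.
- exact/ltW/(le_lt_trans _ ca).
- exact/ltW/(lt_le_trans bw).
- by rewrite negb_and -!ltNge bw orbT.
- move=> u /andP[au ub]; apply: sarc.
  by rewrite (lt_le_trans ca au) /= (le_trans ub) ?ltW.
Unshelve. all: by end_near.
Qed.

Lemma strand_meets_frontier s : strands D s -> s `&` U !=set0 -> ~ s `<=` U ->
  exists w, [/\ params w, s (pt w) & frontier U (pt w)].
Proof.
move=> Ds sU nsU; have [_ _ sconn _] := strands_ofP _ _ Ds.
have [p [sp Fp]] := connected_meets_frontier _ _ _ sconn surface_closed sU nsU.
by have [w Pw ew] := strand_param _ _ Ds sp; exists w; rewrite ew.
Qed.

(** Were the strand leaving U at its frontier point w, it would be outside U
    just after w and inside U just before z, with no frontier point in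
    between. *)
Lemma arrives_inside_incoming s z : strands D s -> ~ s `<=` U -> params z ->
  crossing_points D (pt z) -> arrives s z -> U (pt z) -> incoming D U s.
Proof.
move=> Ds nsU Pz cz sz Uz.
have Unear : \forall u \near z.2^'-, U (curve z.1 u).
  by apply: cvg_within; exact: crossing_near_inside.
have [w [Pw sw Fw]] : exists w, [/\ params w, s (pt w) & frontier U (pt w)].
  apply: strand_meets_frontier => //; near (z.2^'-) => u.
  by exists (curve z.1 u); split; near: u.
exists w; split=> //; have [f Uf df0] := transverse_crossing _ Pw Fw.
exists f => //; rewrite lt_neqAle eq_sym df0 leNgt /=; apply/negP => df_lt0.
have [wz wz2 sarc] := arrives_after no_closed _ _ _ Ds Pz cz sz Pw sw.
have [Uout _] := curve_exits _ _ Uf df_lt0.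
have /andP[_ z1] := (params_segment no_closed z).1 Pz.
have side := strand_side_after _ _ _ Ds Pw sw Fw wz2 z1 sarc.
near (w.2^'+) => a; near (z.2^'-) => b.
have [_ UbUa] : U (curve w.1 a) <-> U (curve w.1 b) by near: b; near: a.
have : ~ U (curve w.1 a) by near: a.
by apply; apply: UbUa; rewrite wz; near: b.
Unshelve. all: by end_near.
Qed.

Lemma leaves_inside_outgoing s z : strands D s -> ~ s `<=` U -> params z ->
  crossing_points D (pt z) -> leaves s z -> U (pt z) -> outgoing D U s.
Proof.
move=> Ds nsU Pz cz sz Uz.
have Unear : \forall u \near z.2^'+, U (curve z.1 u).
  by apply: cvg_within; exact: crossing_near_inside.
have [w [Pw sw Fw]] : exists w, [/\ params w, s (pt w) & frontier U (pt w)].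
  apply: strand_meets_frontier => //; near (z.2^'+) => u.
  by exists (curve z.1 u); split; near: u.
exists w; split=> // -[f Uf df_gt0].
have [wz wz2 sarc] := leaves_before no_closed _ _ _ Ds Pz cz sz Pw sw.
have [_ Uout] := curve_enters _ _ Uf df_gt0.
have /andP[z0 _] := (params_segment no_closed z).1 Pz.
have side := strand_side_before _ _ _ Ds Pw sw Fw wz2 z0 sarc.
near (w.2^'-) => b; near (z.2^'+) => a.
have [UaUb _] : U (curve w.1 a) <-> U (curve w.1 b) by near: a; near: b.
have : ~ U (curve w.1 b) by near: b.
by apply; apply: UaUb; rewrite wz; near: a.
Unshelve. all: by end_near.
Qed.

Lemma incoming_arrives_inside s z : strands D s -> incoming D U s -> params z ->
  crossing_points D (pt z) -> arrives s z -> U (pt z).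
Proof.
move=> Ds [w [Pw sw Fw [f Uf df_gt0]]] Pz cz sz; apply/not_notP => nUz.
have nUz' : nbhs (pt z) (~` U).
  by apply: open_nbhs_nbhs; split=> //; exact/closed_openC/surface_closed.
have nUnear : \forall u \near z.2^'-, ~ U (curve z.1 u).
  by apply: cvg_within; exact: (curve_continuous z.1 z.2 _ nUz').
have [wz wz2 sarc] := arrives_after no_closed _ _ _ Ds Pz cz sz Pw sw.
have [Uin _] := curve_enters _ _ Uf df_gt0.
have /andP[_ z1] := (params_segment no_closed z).1 Pz.
have side := strand_side_after _ _ _ Ds Pw sw Fw wz2 z1 sarc.
near (w.2^'+) => a; near (z.2^'-) => b.
have [UaUb _] : U (curve w.1 a) <-> U (curve w.1 b) by near: b; near: a.
have : ~ U (curve z.1 b) by near: b.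
by apply; rewrite -wz; apply: UaUb; near: a.
Unshelve. all: by end_near.
Qed.

(** Both conditions speak of the only frontier point of s, which has a single
    parameter. *)
Lemma incoming_not_outgoing s : strands D s -> incoming D U s -> ~ outgoing D U s.
Proof.
move=> Ds [x [Px sx Fx into]] [y [Py sy Fy]]; apply.
suff <- : x = y by [].
by apply: (strand_inj _ _ _ Ds sx) => //; exact: (meet_once _ Ds).
Qed.

Lemma arrives_closure s z : arrives s z -> closure s (pt z).
Proof.
move=> sz B Bz.
have Bnear : \forall u \near z.2^'-, B (curve z.1 u).
  by apply: cvg_within; exact: (curve_continuous z.1 z.2 _ Bz).
by near (z.2^'-) => u; exists (curve z.1 u); split; near: u.
Unshelve. all: by end_near.
Qed.

Lemma leaves_closure s z : leaves s z -> closure s (pt z).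
Proof.
move=> sz B Bz.
have Bnear : \forall u \near z.2^'+, B (curve z.1 u).
  by apply: cvg_within; exact: (curve_continuous z.1 z.2 _ Bz).
by near (z.2^'+) => u; exists (curve z.1 u); split; near: u.
Unshelve. all: by end_near.
Qed.

Lemma closure_inside s p : s `<=` U -> closure s p -> U p.
Proof.
by move=> /closureS sU /sU; rewrite -(closure_id U).1 //; exact: surface_closed.
Qed.

End Frontier.

(** * Transitions between strands *)

Section Transitions.
Context {R : realType} {Sigma : set (plane R)} {D : tangle_diagram Sigma}.
Implicit Types (x y z : 'I_(ncomp D) * R) (s t X : set (plane R)).

Lemma crossing_crossing_points x y : crossing x y ->
  [/\ params x, params y, pt x = pt y & crossing_points D (pt x)].
Proof. by move=> xy; case: (xy) => Px Py exy _; split=> //; exists x, y. Qed.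

Lemma trans_neq0 X s t : trans (subchain D X) s t != 0 ->
  transition D X s t (trans (subchain D X) s t).
Proof. by rewrite /=; case: xgetP => // _; rewrite eqxx. Qed.

Definition joined_at s t z z' : Prop :=
  [/\ params z, params z', pt z = pt z', crossing_points D (pt z) &
      arrives s z /\ leaves t z'].

Lemma transition_joined_at X s t v : transition D X s t v ->
  exists z z', joined_at s t z z' /\ X (pt z).
Proof.
case=> x y /crossing_crossing_points[Px Py exy cx] Xx sx tx.
- by exists x, x.
- by exists x, y.
- by exists y, y; rewrite -exy; split=> //; split; rewrite -?exy.
Qed.

(** At T = 1 only the transitions that go straight through the crossing
    survive: the weight of turning from the over-strand to the under-strand
    vanishes. *)
Lemma transition_at_one X s t v : transition D X s t v ->
  value_at_one v 0 \/ value_at_one v 1 /\ exists z, joined_at s t z z.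
Proof.
case=> x y /crossing_crossing_points[Px Py exy cx] Xx sx tx.
- by right; split; [exact: value_at_one_sign|exists x].
- left; rewrite -[0](subrr 1); apply: value_at_oneB; first exact: value_at_one1.
  exact: value_at_one_sign.
- by right; split; [exact: value_at_one1|exists y; split; rewrite -?exy].
Qed.

(** The transition from s to t is determined by the crossings at which s ends
    and t starts, so a region containing them gives it the same weight. *)
Lemma trans_chain_local X s t : X `<=` Sigma ->
  (forall z z', joined_at s t z z' -> X (pt z)) ->
  trans (chain D) s t = trans (subchain D X) s t.
Proof.
move=> XS inX; congr (xget _ _); apply/seteqP; split=> v st.
  case: st inX => x y xy Sx sx tx inX;
    have [Px Py exy cx] := crossing_crossing_points _ _ xy.
  - by apply: over_over => //; apply: (inX x x).
  - by apply: over_under => //; apply: (inX x y).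
  - apply: (under_under xy _ sx tx); rewrite exy; apply: (inX y y).
    by split; rewrite -?exy.
case: st => x y xy Xx sx tx.
- by apply: over_over => //; exact: XS.
- by apply: over_under => //; exact: XS.
- by apply: (under_under xy _ sx tx); exact: XS.
Qed.

End Transitions.

(** * The determinant of the contraction *)

Theorem proposition3p4 (R : realType) (Sigma : set (plane R))
    (D : tangle_diagram Sigma) (U : set (plane R))
    (n m : nat) (AD : 'M[ZT]_n) (ADU : 'M[ZT]_m)
    (Sigma_surface : compact_surface Sigma)
    (D_no_closed : no_closed_component D)
    (U_surface : compact_surface U)
    (U_interior : U `<=` Sigma°)
    (U_transverse : transverse_to D U)
    (U_avoids : frontier U `&` crossing_points D = set0)
    (strands_meet_once :
      forall s, strands D s -> is_subset1 (s `&` frontier U))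
    (AD_transition : is_transition_matrix (chain D) AD)
    (ADU_transition : is_transition_matrix (contracted_chain D U) ADU)
    (U_acyclic : acyclic (subchain D U)) :
  \det (1%:M - AD) = \det (1%:M - ADU) /\
  [/\ 1%:M - AD \in unitmx, 1%:M - ADU \in unitmx &
      \det (invmx (1%:M - AD)) = \det (invmx (1%:M - ADU))].
Proof.
have USigma : U `<=` Sigma by move=> p /U_interior; exact: interior_subset.
have [e [eD ADe]] := AD_transition; have [e' [e'DU ADUe']] := ADU_transition.
have chainP s : states (chain D) s <-> strands D s.
  split=> [|Ds]; first by move=> /substrandsP[].
  apply/substrandsP => //; split=> //.
  have [[p sp] sA _ _] := strands_ofP _ _ Ds.
  by exists p; split=> //; have [[_ Sp] _] := sA p sp.
have outsideP s : substrands D (Sigma `\` U) s <-> strands D s /\ ~ s `<=` U.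
  rewrite substrandsP; last exact: subDsetl.
  split=> [[Ds [p [sp [_ nUp]]]]|[Ds]].
    by split=> // sU; exact/nUp/sU.
  have [_ sA _ _] := strands_ofP _ _ Ds.
  move=> /existsNP[p /not_implyP[sp nUp]]; split=> //; exists p; split=> //.
  by split=> //; have [[]] := sA p sp.
have detE : \det (1%:M - AD) = \det (1%:M - ADU).
  rewrite ADe ADUe'.
  have inside s t : strands D s -> strands D t -> s `<=` U \/ t `<=` U ->
      trans (chain D) s t = trans (subchain D U) s t.
    move=> Ds Dt stU; apply: trans_chain_local => // z z' [_ _ ezz' _ [sz tz']].
    case: stU => /(closure_inside U_surface); apply; first exact: arrives_closure.
    by rewrite ezz'; exact: leaves_closure.
  apply: (@det_contraction _ (chain D) (subchain D U) (substrands D (Sigma `\` U))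
    (incoming D U) (outgoing D U) _ _ e e' eD e'DU).
  - by move=> s /outsideP[Ds _]; exact/chainP.
  - by move=> s /substrandsP[] // Ds _; exact/chainP.
  - move=> s [/chainP Ds nsE]; apply/substrandsP => //; split=> //.
    have [[p sp] _ _ _] := strands_ofP _ _ Ds.
    by exists p; split=> //; apply: contra_notP nsE => nUp; apply/outsideP; split=> // /(_ _ sp).
  - exact: U_acyclic.
  - move=> s [/outsideP[Ds _] [x [Px sx [Ux _] _]]]; apply/substrandsP => //.
    by split=> //; exists (pt x).
  - move=> s [/outsideP[Ds _] [x [Px sx [Ux _] _]]]; apply/substrandsP => //.
    by split=> //; exists (pt x).
  - move=> s /outsideP[Ds _]; exact: (incoming_not_outgoing strands_meet_once).
  - move=> s t /chainP Ds /chainP Dt nst; apply: inside => //.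
    by apply: contra_notP nst => /not_orP[nsU ntU]; split; apply/outsideP.
  - move=> s t /outsideP[Ds _] _ Is _; apply: trans_chain_local => //.
    move=> z z' [Pz _ _ cz [sz _]].
    exact: (incoming_arrives_inside D_no_closed U_surface strands_meet_once _ _ Ds Is Pz cz sz).
  - move=> s t /outsideP[Ds nsU] _ /trans_neq0/transition_joined_at.
    move=> [z [z' [[Pz _ _ cz [sz _]] Uz]]].
    exact: (arrives_inside_incoming D_no_closed U_surface U_transverse U_avoids
      strands_meet_once _ _ Ds nsU Pz cz sz).
  - move=> s t _ /outsideP[Dt ntU] /trans_neq0/transition_joined_at.
    move=> [z [z' [[_ Pz' ezz' + [_ tz']] +]]]; rewrite ezz' => cz' Uz'.
    exact: (leaves_inside_outgoing D_no_closed U_surface U_avoids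
      strands_meet_once _ _ Dt ntU Pz' cz' tz').
have det_neq0 : \det (1%:M - AD) != 0.
  have eS i : strands D (e i) by have [eM _ _] := eD; apply/chainP; exact: eM.
  (* A strand is ranked by the parameter tau of one of its points. *)
  have /choice[tau tauP] : forall i, exists x : 'I_(ncomp D) * R,
      params x /\ e i (pt x).
    move=> i; have [[p ep] _ _ _] := strands_ofP _ _ (eS i).
    by have [x Px xp] := strand_param _ _ (eS i) ep; exists x; rewrite xp.
  apply: (@det_neq0_at_one _ _ _ (fun i => (tau i).2)) => i j.
  rewrite ADe mxE; have [->|/trans_neq0/transition_at_one] :=
    eqVneq (trans (chain D) (e i) (e j)) 0.
    by exists 0 => //; exact: value_at_one0.
  case=> [v0|[v1 [z [Pz _ _ cz [iz jz]]]]]; first by exists 0.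
  exists 1 => // _; have [Pi ei] := tauP i; have [Pj ej] := tauP j.
  have [_ iltz _] := arrives_after D_no_closed _ _ _ (eS i) Pz cz iz Pi ei.
  have [_ zltj _] := leaves_before D_no_closed _ _ _ (eS j) Pz cz jz Pj ej.
  exact: lt_trans zltj.
by rewrite !unitmxE !unitfE !det_inv -detE.
Qed.
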